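(* Let $X$ be a real complete Hausdorff locally convex space with topological dual $X^*$. Let $A$ and $B$ be nonempty bounded closed convex subsets of $X$ such that $0\notin\operatorname{cl}(A-B)$. If every $x^*\in X^*$ with $$\sup_{x\in B}\langle x^*,x\rangle<\inf_{x\in A}\langle x^*,x\rangle$$ attains its infimum on $A$ and its supremum on $B$, then both $A$ and $B$ are weakly compact.
   Context: $\langle x^*,x\rangle:=x^*(x)$ for $x^*\in X^*$, $x\in X$. $\operatorname{cl}$ denotes the closure in $X$ for its locally convex topology, and $A-B:=\{a-b: a\in A,\ b\in B\}$. *)

(* Defs.v *)
From HB Require Import structures.
From mathcomp Require Import all_boot all_order all_algebra.
From mathcomp Require Import all_classical all_reals all_analysis.

Set Implicit Arguments.
Unset Strict Implicit.
Unset Printing Implicit Defensive.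

Import Order.TTheory GRing.Theory Num.Theory.
Import numFieldNormedType.Exports.

Local Open Scope classical_set_scope.
Local Open Scope ring_scope.

Section LocallyConvex.
Context (R : realType) (X : tvsType R).

(* [tvsType] carries some uniform structure inducing the topology, but nothing
   makes it the translation-invariant one. Completeness of a topological vector
   space refers to the latter, hence Cauchy filters are defined from the
   neighbourhoods of 0 rather than with [cauchy]. *)
Definition tvs_cauchy (F : set_system X) :=
  forall U : set X, nbhs 0 U -> \forall x & y \near F, U (x - y).

Definition tvs_complete :=
  forall F : set_system X, ProperFilter F -> tvs_cauchy F ->
    exists x : X, F --> x.

(* von Neumann boundedness: every neighbourhood of 0 absorbs A *)
Definition tvs_bounded (A : set X) :=
  forall U : set X, nbhs 0 U ->
    exists2 r : R, 0 < r & forall t : R, r < t -> A `<=` [set t *: u | u in U].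

Definition dual := {f : {scalar X} | continuous (f : X -> R)}.

Definition dual_fun (f : dual) : X -> R := sval f.
Coercion dual_fun : dual >-> Funclass.

(* X with the coarsest topology making every element of the dual continuous *)
Definition weak : topologicalType :=
  sup_topology
    (fun f : dual => Topological.on (initial_topology (f : X -> R))).

Definition weakly_compact (A : set X) := @compact weak A.

(* [inf] and [sup] are the genuine infimum and supremum when f is bounded on
   the nonempty set A, and are 0 otherwise. *)
Definition attains_inf (f : X -> R) (A : set X) :=
  exists2 a, A a & f a = inf (f @` A).

Definition attains_sup (f : X -> R) (A : set X) :=
  exists2 a, A a & f a = sup (f @` A).

End LocallyConvex.

(* Main.v *)
(** The difference [K = A - B] is bounded and convex, and some [p] in the dual
satisfies [p >= m > 0] on [K]. For [h] in the dual let [t] be the supremum of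
[(1 + h) / p] on [K]; then [t p - h] has infimum [1] on [K], so the hypothesis
makes [(1 + h) / p] attain its supremum on [K]. Thus the perturbations of [1 / p]
by the functions [h / p] all attain their suprema, which is what the argument of
James and Pryce needs.

An ultrafilter on [K] has a pointwise limit [z] on the dual. If [z] is not the
evaluation at a point, completeness gives an equicontinuous set of functionals on
which [z] stays away from every evaluation, hence functionals [f n] in it and
points [x j] of [K] with [f n (x j) = 0] for [j < n] and [f n (x j) > L] for
[n <= j]. Refine the sequence of the convex blocks of the [f n] until the suprema
of [1 / p + c g / p - limsup] become stable for all [g] in a countable set of
blocks, choose blocks [g n] successively almost minimizing these suprema, and let
[w] be a cluster point of the [g n]. The function
[(1 + c (\sum_k (1 - q) q^k g k - w)) / p] does not attain its supremum. *)
Require Import Defs.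
From HB Require Import structures.
From mathcomp Require Import all_boot all_order all_algebra.
From mathcomp Require Import ring lra.
From mathcomp Require Import all_classical all_reals all_analysis.

Set Implicit Arguments.
Unset Strict Implicit.
Unset Printing Implicit Defensive.

Import Order.TTheory GRing.Theory Num.Theory.
Import numFieldNormedType.Exports.

Local Open Scope classical_set_scope.
Local Open Scope ring_scope.

(** * Pryce's argument for an abstract bounded family of functions closed under mixing *)

Section JamesPryce.
Context (R : realType) (E : Type) (I : countType) (ev : I -> E -> R)
  (mix : I -> I -> I) (q M b : R) (F : E -> R) (x0 : E).
Context (q_gt0 : 0 < q) (q_lt1 : q < 1)
  (ev_mix : forall i j x, ev (mix i j) x = (1 - q) * ev i x + q * ev j x)
  (ev_le : forall i x, `|ev i x| <= M) (F_le : forall x, `|F x| <= b).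

(** A sequence of convex blocks is encoded by the decreasing sets of blocks still allowed, so that
    passing to further blocks becomes inclusion. *)
Definition tails (C : nat -> set I) :=
  [/\ forall n, C n !=set0, forall n, C n.+1 `<=` C n &
      forall n i j, C n i -> C n j -> C n (mix i j)].

Definition refines (D C : nat -> set I) := forall n, D n `<=` C n.

Definition gaps (C : nat -> set I) i : set R :=
  [set r | exists x n, forall j, C n j -> r + ev j x <= F x + ev i x].

(* [gap C i] is the supremum over [x] of [F x + ev i x - u x], where [u x] is
   the infimum over [n] of the suprema of [ev j x] over [j] in [C n]. *)
Definition gap C i := sup (gaps C i).

Lemma tails_le C m n : tails C -> (m <= n)%N -> C n `<=` C m.
Proof.
move=> [_ dC _]; elim: n => [|n IH]; first by rewrite leqn0 => /eqP ->.
by rewrite leq_eqVlt => /predU1P[->//|/IH]; apply: subset_trans; exact: dC.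
Qed.

Lemma tails_shift C n : tails C -> tails (fun k => C (k + n)%N).
Proof. by move=> [C0 dC mC]; split=> // [k|k]; [exact: dC|exact: mC]. Qed.

Lemma has_sup_gaps C i : tails C -> has_sup (gaps C i).
Proof.
move=> [C0 _ _]; split.
  exists (- b - 2 * M); exists x0, 0%N => j _.
  move: (ev_le i x0) (ev_le j x0) (F_le x0); rewrite !ler_norml; lra.
exists (b + 2 * M) => r [x [n Hr]].
have [j /Hr] := C0 n.
move: (ev_le i x) (ev_le j x) (F_le x); rewrite !ler_norml; lra.
Qed.

Lemma gap_ub C i r : tails C -> gaps C i r -> r <= gap C i.
Proof. by move=> tC Hr; apply: sup_upper_bound => //; exact: has_sup_gaps. Qed.

Lemma gap_le C D i : tails C -> gaps C i `<=` gaps D i -> tails D ->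
  gap C i <= gap D i.
Proof.
move=> tC sub tD; apply: ge_sup; first by have [] := has_sup_gaps i tC.
by move=> r /sub; exact: gap_ub.
Qed.

(** Fewer blocks lower the limit superior that is subtracted, so refining can only raise a gap. *)
Lemma gap_refines C D i : tails C -> tails D -> refines D C ->
  gap C i <= gap D i.
Proof.
move=> tC tD rDC; apply: gap_le => // r [x [n Hr]].
by exists x, n => j /rDC; exact: Hr.
Qed.

(** A limit superior ignores the first terms; the reverse inequality is an instance of
    [gap_refines]. *)
Lemma gap_shift C i n : tails C -> gap (fun k => C (k + n)%N) i <= gap C i.
Proof.
move=> tC; apply: gap_le => //; first exact: tails_shift.
by move=> r [x [m Hr]]; exists x, (m + n)%N.
Qed.

Lemma gap_leM C i : tails C -> gap C i <= b + 2 * M.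
Proof.
move=> tC; apply: ge_sup; first by have [] := has_sup_gaps i tC.
move=> r [x [n Hr]]; have [C0 _ _] := tC; have [j /Hr] := C0 n.
move: (ev_le i x) (ev_le j x) (F_le x); rewrite !ler_norml; lra.
Qed.

(** Gaps are bounded by [b + 2 * M], so some refinement comes within [e] of the supremum over all
    refinements and leaves later ones no more room than that. *)
Lemma refine_gap C i e : 0 < e -> tails C ->
  exists2 D, tails D /\ refines D C &
    forall D', tails D' -> refines D' D -> gap D' i <= gap D i + e.
Proof.
move=> e0 tC; pose S := [set gap D i | D in [set D | tails D /\ refines D C]].
have supS : has_sup S.
  split; first by exists (gap C i); exists C => //; split=> // n.
  by exists (b + 2 * M) => _ [D [tD _] <-]; exact: gap_leM.
have [_ [D [tD rD] <-] Dgap] := sup_adherent e0 supS.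
exists D => // D' tD' rD'.
have : gap D' i <= sup S.
  apply: sup_upper_bound => //; exists D' => //; split=> // n.
  by move=> j /rD' /rD.
by move: Dgap; lra.
Qed.

(** A diagonal argument over the countable type [I]: each index is treated once for every tolerance
    [k.+1%:R^-1]. *)
Lemma refine_all_gaps C : tails C ->
  exists2 D, tails D /\ refines D C &
    forall i D', tails D' -> refines D' D -> gap D' i <= gap D i.
Proof.
move=> tC.
(* Stage [a.1] treats the pair of an index and a tolerance that it encodes; a number encoding no
   pair leaves the sets unchanged. *)
have step (a : nat * (nat -> set I)) : {D | tails a.2 ->
    [/\ tails D, refines D a.2 & forall i k, unpickle a.1 = Some (i, k) ->
      forall D', tails D' -> refines D' D -> gap D' i <= gap D i + k.+1%:R^-1]}.
  apply: cid; case: a => n C' /=.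
  have [tC'|] := pselect (tails C'); last by exists C'.
  case E1: (unpickle n) => [[i k]|]; last by exists C' => _; split=> // j.
  have [|D [tD rD] HD] := @refine_gap C' i k.+1%:R^-1 _ tC'.
    by rewrite invr_gt0.
  by exists D => _; split=> // i' k' [<- <-].
pose chain := fix chain n := if n is m.+1 then sval (step (m, chain m)) else C.
have tchain n : tails (chain n).
  by elim: n => [//|n IH] /=; case: (svalP (step (n, chain n)) IH).
have rchain n k : (n <= k)%N -> refines (chain k) (chain n).
  move/subnK <-; elim: (k - n)%N => [|m IH] j /=; first exact: id.
  apply: subset_trans (IH j).
  by case: (svalP (step (m + n, chain (m + n))%N) (tchain _)) => _ /(_ j).
(* From rank [n] on, the diagonal refines [chain n]; as gaps are insensitive to shifts, it inherits
   the stability obtained at each stage. *)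
pose D k := chain k k.
have rD n k : (n <= k)%N -> D k `<=` chain n k by move=> nk; exact: rchain.
have tD : tails D.
  split=> n; first by have [+ _ _] := tchain n; exact.
    by apply: (subset_trans (rchain n n.+1 _ _)) => //; have [_ + _] := tchain n; exact.
  by have [_ _] := tchain n; exact.
exists D; first by split=> // n; exact: (rD 0%N n).
move=> i D' tD' rD'; apply/ler_addgt0Pr => e e0.
have [k ke] : exists k, k.+1%:R^-1 <= e.
  exists (Num.truncn e^-1); rewrite invf_ple ?posrE//.
  by apply: ltW; exact: truncnS_gt.
have := svalP (step (pickle (i, k), chain (pickle (i, k)))) (tchain _) => -[].
set n := (pickle (i, k)).+1; rewrite -/(chain n) => _ _ /(_ i k (pickleK _)) H.
have rDn D0 : refines D0 D -> refines (fun j => D0 (j + n)%N) (chain n).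
  move=> rD0 j; apply: (subset_trans (rD0 _)).
  apply: (subset_trans (rD n _ _)); first by rewrite leq_addl.
  by apply: tails_le; rewrite ?leq_addr.
have le1 : gap D' i <= gap (fun k => D' (k + n)%N) i.
  apply: gap_refines => //; first exact: tails_shift.
  by move=> j; apply: tails_le; rewrite ?leq_addr.
have le2 : gap (fun k => D' (k + n)%N) i <= gap (chain n) i + k.+1%:R^-1.
  by apply: H; [exact: tails_shift|exact: rDn].
have le3 : gap (chain n) i <= gap (fun k => D (k + n)%N) i.
  by apply: gap_refines => //; [exact: tails_shift|apply: rDn => j].
apply: le_trans le1 (le_trans le2 _).
by rewrite lerD// (le_trans le3)// gap_shift.
Qed.

(* Cutting every [D n] by the half-space of the values at most [a] at [x] gives
   a refinement of [D]. *)
Lemma gap_slice D i x a : tails D ->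
  (forall D', tails D' -> refines D' D -> gap D' i <= gap D i) ->
  (forall n, exists2 j, D n j & ev j x <= a) -> F x + ev i x - a <= gap D i.
Proof.
move=> tD stD Da; pose D' n := [set j | D n j /\ ev j x <= a].
have tD' : tails D'.
  have [_ dD mD] := tD; split=> n; first by have [j] := Da n; exists j.
    by move=> j [/dD].
  move=> j k [Dj ja] [Dk ka]; split; first exact: mD.
  rewrite ev_mix; apply: (@le_trans _ _ ((1 - q) * a + q * a)); last by lra.
  by apply: lerD; apply: ler_wpM2l => //; [rewrite subr_ge0|]; exact: ltW.
apply: le_trans (stD D' tD' _); last by move=> n j [].
by apply: gap_ub => //; exists x, 0%N => j [_ ja]; lra.
Qed.

Lemma gap_near_min D (c : I -> I) n e : 0 < e -> tails D ->
  exists2 i, D n i & forall j, D n j -> gap D (c i) <= gap D (c j) + e.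
Proof.
move=> e0 tD; have [/(_ n) [i0 Di0] _ _] := tD.
have lbS : has_inf [set gap D (c i) | i in D n].
  split; first by exists (gap D (c i0)), i0.
  exists (- b - 2 * M) => _ [i Di <-]; apply: gap_ub => //.
  exists x0, 0%N => j _.
  move: (ev_le (c i) x0) (ev_le j x0) (F_le x0); rewrite !ler_norml; lra.
have [_ [i Di <-] ilt] := inf_adherent e0 lbS.
exists i => // j Dj; apply/ltW/(lt_le_trans ilt); rewrite lerD2r.
by apply: ge_inf; [exact: lbS.2|exists j].
Qed.

(** At a maximum point [x], the almost minimality of the [g n] would keep [ev (g n) x] at least
    [4^-1] above [w x], although it converges to [w x] along [U]. *)
Lemma not_attained C : tails C -> 8 * (q * M) <= 1 ->
  (forall i, exists x n, forall j, C n j -> 2 * b + 1 + ev j x <= ev i x) ->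
  exists2 g : nat -> I, forall n, C n (g n) &
  forall (U : set_system nat) (w s : E -> R), ProperFilter U ->
    \oo `<=` U -> (forall x, ev (g n) x @[n --> U] --> w x) ->
    (forall x, \sum_(k < n) (1 - q) * q ^+ k * ev (g k) x @[n --> U] --> s x) ->
    forall x, exists y, F x + s x - w x < F y + s y - w y.
Proof.
move=> tC qM farC; have [D [tD rD] stD] := refine_all_gaps tC.
have M_ge0 : 0 <= M.
  have [/(_ 0%N)[i _] _ _] := tC.
  by apply: le_trans (ev_le i x0); rewrite normr_ge0.
(* This tolerance is what the induction for [d_ge] can afford: there the term [2^-1 ^+ n.+1] may be
   halved at each step. *)
pose e n := q ^+ n.+1 * 2^-1 ^+ n.+2.
have e0 n : 0 < e n by rewrite mulr_gt0// exprn_gt0// invr_gt0.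
have pickP (a : nat * (I -> I)) : {i | D a.1 i /\
    forall j, D a.1 j -> gap D (a.2 i) <= gap D (a.2 j) + e a.1}.
  by apply: cid; have [i] := gap_near_min a.2 a.1 (e0 a.1) tD; exists i.
pose pick a := sval (pickP a).
(* [ctx n] is the nested mixture of [g 0], ..., [g n.-1] with a hole in its innermost place. Each
   [g n] is picked to almost minimize the gap after filling that hole. *)
pose ctx := fix ctx n i := if n is m.+1 then ctx m (mix (pick (m, ctx m)) i)
  else i.
pose g n := pick (n, ctx n).
have Dg n : D n (g n) by have [] := svalP (pickP (n, ctx n)).
have gmin n j : D n j -> gap D (ctx n (g n)) <= gap D (ctx n j) + e n.
  by have [_] := svalP (pickP (n, ctx n)); apply.
exists g => [n|U w s FU ooU cw cs x]; first exact/rD/Dg.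
pose S n y := \sum_(k < n) (1 - q) * q ^+ k * ev (g k) y.
have S0 y : S 0%N y = 0 by rewrite /S big_ord0.
have SS n y : S n.+1 y = S n y + (1 - q) * q ^+ n * ev (g n) y.
  by rewrite /S big_ord_recr.
have cS y : S n y @[n --> U] --> s y by exact: cs.
(* The body of [S] is forgotten; only its recursion and its limit are used below. *)
move: S S0 SS cS => S S0 SS cS.
have ev_ctx n i y : ev (ctx n i) y = S n y + q ^+ n * ev i y.
  elim: n i => [|n IH] i; first by rewrite S0 expr0; lra.
  by rewrite /= IH ev_mix -/(g n) SS exprS; ring.
(* The inner layers of the mixture form a block of [D n], because [D n] is closed under [mix]. *)
have ctx_tail n m i : D (n + m)%N i -> exists2 t, D n t & ctx (n + m)%N i = ctx n t.
  elim: m i => [|m IH] i; first by rewrite addn0; exists i.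
  rewrite addnS => Di /=; apply: IH; have [_ dD mD] := tD.
  by apply: mD; [exact: Dg|exact: dD].
have qn_gt0 n : 0 < q ^+ n by rewrite exprn_gt0.
have S_near n m y : `|S (n + m)%N y - S n y| <= M * (q ^+ n - q ^+ (n + m)).
  elim: m => [|m IH]; first by rewrite addn0 !subrr normr0 mulr0.
  rewrite addnS SS exprS.
  set p := q ^+ (n + m) in IH *; set a := ev _ _.
  have : `|(1 - q) * p * a| <= (1 - q) * p * M.
    have p0 : 0 <= (1 - q) * p by apply: mulr_ge0; [rewrite subr_ge0|]; apply: ltW => //; exact: qn_gt0.
    by rewrite normrM ger0_norm// ler_wpM2l//; exact: ev_le.
  by move: IH; rewrite !ler_norml => /andP[? ?] /andP[? ?]; apply/andP; split; lra.
have s_near n y : `|s y - S n y| <= M * q ^+ n.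
  have : `|S m y - S n y| @[m --> U] --> `|s y - S n y|.
    by apply: cvg_norm; apply: cvgB; [exact: cS|exact: cvg_cst].
  move/cvgr_to_le; apply; apply: ooU; exists n => // m /= nm.
  rewrite -(subnKC nm); apply: le_trans (S_near _ _ _) _.
  by rewrite ler_wpM2l// gerBl exprn_ge0// ltW.
apply: contrapT => xmax; pose mu := F x + s x - w x.
have {}xmax y : F y + s y - w y <= mu.
  by rewrite leNgt; apply/negP => lt_y; apply: xmax; exists y.
(* Along [U] the [g k] eventually lie in each [D n], so the limit superior dominates [w]; and
   [ctx N (g N)] differs from [s] by at most [2 * (M * q ^+ N)]. *)
have gap_mu N : gap D (ctx N (g N)) <= mu + 2 * (M * q ^+ N).
  apply: ge_sup; first by have [] := has_sup_gaps (ctx N (g N)) tD.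
  move=> r [y [n Hr]].
  have : r + w y <= F y + ev (ctx N (g N)) y.
    have : (r + ev (g k) y) @[k --> U] --> r + w y.
      by apply: cvgD; [exact: cvg_cst|exact: cw].
    move/cvgr_to_le; apply; apply: ooU; exists n => // k /= nk.
    by apply/Hr/(tails_le tD nk)/Dg.
  rewrite ev_ctx; have := xmax y; have := s_near N y.
  have : q ^+ N * ev (g N) y <= q ^+ N * M.
    by rewrite ler_pM2l// (le_trans (ler_norm _)).
  by rewrite ler_norml => ? /andP[? ?]; lra.
have gap_mu_lb n v : (forall j, D n j -> v <= gap D (ctx n j)) -> v <= mu.
  move=> Hv.
  have cM : (mu + 2 * (M * q ^+ k)) @[k --> \oo] --> mu.
    rewrite -[X in _ --> X]addr0; apply: cvgD; first exact: cvg_cst.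
    rewrite -(mulr0 2); apply: cvgMr.
    rewrite -(mulr0 M); apply: cvgMr.
    by apply: cvg_expr; rewrite ger0_norm// ltW.
  apply: (cvgr_to_ge cM); exists n => // k /= nk.
  apply: le_trans (gap_mu k).
  have := @ctx_tail n (k - n)%N (g k); rewrite subnKC// => -[//|t Dt ->].
  exact: Hv.
(* The half-space of values at most [w x + d] meets every [D k], in some [g m], so [gap_slice]
   bounds the left side by the gap of [ctx n (g n)], which is almost minimal. *)
have mu_g n : F x + S n x + q ^+ n * ev (g n) x - w x <= mu + e n.
  apply: (@le_trans _ _ (gap D (ctx n (g n)))); last first.
    rewrite -lerBlDr; apply: (gap_mu_lb n) => j Dj.
    by rewrite lerBlDr gmin.
  apply/ler_addgt0Pr => d d0; rewrite -lerBlDr.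
  rewrite (_ : _ - d = F x + ev (ctx n (g n)) x - (w x + d)); last first.
    by rewrite ev_ctx; ring.
  apply: gap_slice => // [D'|k]; first exact: stD.
  have : \forall n \near U, (k <= n)%N /\ ev (g n) x <= w x + d.
    apply: filterI; first by apply: ooU; exists k.
    by apply: (cvgr_le _ (cw x)); rewrite ltrDl.
  move=> /filter_ex[m [km gm]]; exists (g m) => //.
  by apply: (tails_le tD km); exact: Dg.
(* By [farC] all gaps are at least [b + 1], hence so is [mu], while [F x] is at most [b]. *)
have s_ge : w x + 1 <= s x.
  have : b + 1 <= mu.
    apply: (gap_mu_lb 0%N) => j _ /=.
    have [y [n Hn]] := farC j; apply: gap_ub => //; exists y, n => k /rD/Hn.
    by have := F_le y; rewrite ler_norml; lra.
  by have := F_le x; rewrite ler_norml /mu; lra.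
(* Bounding [q ^+ n * ev (g n) x] by [mu_g] gives [s x - S n.+1 x >= q * (s x - S n x) - (1 - q) * e
   n]. *)
have d_ge n : q ^+ n * (w x + 2^-1 + 2^-1 ^+ n.+1) <= s x - S n x.
  elim: n => [|n IH]; first by rewrite S0 expr0 expr1; lra.
  have := mu_g n; rewrite /mu /e SS exprS.
  move: IH; rewrite [2^-1 ^+ n.+2]exprS.
  set h := 2^-1 ^+ n.+1; set p := q ^+ n; set v := ev _ _ => IH Hmu.
  have ub : p * v <= s x - S n x + q * p * (2^-1 * h) by lra.
  have h0 : 0 < h by rewrite exprn_gt0// invr_gt0.
  have p0 : 0 < p by exact: qn_gt0.
  have q1 : 0 <= 1 - q by rewrite subr_ge0 ltW.
  have := ler_wpM2l q1 ub; have := ler_wpM2l (ltW q_gt0) IH.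
  have : 0 <= q * q * p * h by rewrite !mulr_ge0// ltW.
  lra.
(* The remainder after [n.+1] terms is at most [M * q ^+ n.+1], so [d_ge] yields
   [ev (g n) x >= w x + 2^-1 - 2 * (q * M)]; the last term is at most [4^-1] by [qM]. *)
have g_ge n : w x + 4^-1 <= ev (g n) x.
  have := d_ge n; have := s_near n.+1 x; rewrite SS exprS.
  have := ev_le (g n) x; rewrite !ler_norml => /andP[v_ge v_le] /andP[d1 d2].
  set h := 2^-1 ^+ n.+1 => d3; set p := q ^+ n in d1 d2 d3.
  have h0 : 0 < h by rewrite exprn_gt0// invr_gt0.
  have p0 : 0 < p by exact: qn_gt0.
  have qM0 : 0 <= q * (ev (g n) x + M) by apply: mulr_ge0; [exact: ltW|lra].
  suff : 0 <= p * ((1 - q) * ev (g n) x - (w x + 2^-1 - q * M)).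
    by rewrite pmulr_rge0//; lra.
  by have := mulr_gt0 p0 h0; lra.
have : \forall n \near U, ev (g n) x < w x + 4^-1.
  by apply: (cvgr_lt _ (cw x)); rewrite ltrDl invr_gt0.
by move=> /filter_ex[n]; rewrite ltNge g_ge.
Qed.

End JamesPryce.

(** * The Hahn-Banach theorem for sublinear functionals and for convex sets *)

Section HahnBanach.
Context (R : realType) (V : lmodType R).
Implicit Types (p : V -> R).

Definition sublinear p :=
  (forall x y, p (x + y) <= p x + p y) /\
  (forall t x, 0 < t -> p (t *: x) <= t * p x).

Lemma sublinear0 p : sublinear p -> p 0 = 0.
Proof.
move=> [pD pZ]; apply/eqP; rewrite eq_le; apply/andP; split.
  by have := pZ 2^-1 0; rewrite scaler0 invr_gt0 => /(_ (ltr0Sn _ _)); lra.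
by have := pD 0 0; rewrite addr0; lra.
Qed.

Lemma sublinearN p x : sublinear p -> - p (- x) <= p x.
Proof.
move=> sp; have [pD _] := sp.
by have := pD x (- x); rewrite subrr sublinear0//; lra.
Qed.

Lemma sublinearZ p t x : sublinear p -> 0 <= t -> p (t *: x) = t * p x.
Proof.
move=> sp; rewrite le_eqVlt => /predU1P[<-|t0].
  by rewrite scale0r mul0r sublinear0.
have [_ pZ] := sp; apply/eqP; rewrite eq_le pZ//=.
have := pZ t^-1 (t *: x); rewrite invr_gt0 => /(_ t0).
by rewrite scalerA mulVf ?gt_eqF// scale1r ler_pdivlMl.
Qed.

(* Lowers [p] so that equality holds in [- p (- v) <= p v]. *)
Lemma sublinear_lower p v : sublinear p ->
  exists2 p', sublinear p' /\ (forall x, p' x <= p x) & p' (- v) <= - p v.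
Proof.
move=> sp; have [pD pZ] := sp.
pose S x := [set p (x + t *: v) - t * p v | t in [set t | 0 <= t]].
have lbS x : has_inf (S x).
  split; first by exists (p (x + 0 *: v) - 0 * p v), 0 => /=.
  exists (- p (- x)) => _ [t /= t0 <-].
  have := pD (x + t *: v) (- x); rewrite addrAC subrr add0r.
  by rewrite sublinearZ//; lra.
have Sle x t : 0 <= t -> inf (S x) <= p (x + t *: v) - t * p v.
  by move=> t0; apply: ge_inf; [exact: (lbS x).2|exists t].
exists (fun x => inf (S x)); last first.
  by have := Sle (- v) 1 ler01; rewrite scale1r addNr sublinear0//; lra.
split; last by move=> x; have := Sle x 0 (lexx 0); rewrite scale0r addr0; lra.
split=> [x y|t x t0].
  apply/ler_addgt0Pr => e e0.
  have e20 : 0 < e / 2 by rewrite divr_gt0.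
  have [_ [s /= s0 <-] Hs] := inf_adherent e20 (lbS x).
  have [_ [t /= t0 <-] Ht] := inf_adherent e20 (lbS y).
  have := Sle (x + y) (s + t) (addr_ge0 s0 t0).
  have := pD (x + s *: v) (y + t *: v).
  by rewrite addrACA -scalerDl; lra.
rewrite -ler_pdivrMl//; apply: lb_le_inf; first exact: (lbS x).1.
move=> _ [s /= s0 <-]; rewrite ler_pdivrMl//.
have := Sle (t *: x) (t * s) (mulr_ge0 (ltW t0) s0).
by rewrite -scalerA -scalerDr sublinearZ ?(ltW t0)//; lra.
Qed.

(** The pointwise infimum of a chain is subadditive because, of two members nearly optimal at [x]
    and at [y], the smaller one serves both points. *)
Lemma sublinear_chain_inf p (A : set (V -> R)) : sublinear p -> A p ->
  (forall r, A r -> sublinear r /\ forall x, r x <= p x) ->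
  (forall r s, A r -> A s -> (forall x, r x <= s x) \/ (forall x, s x <= r x)) ->
  exists2 m, sublinear m & forall r, A r -> forall x, m x <= r x.
Proof.
move=> sp Ap HA totA; pose S x := [set r x | r in A].
have lbS x : has_inf (S x).
  split; first by exists (p x), p.
  exists (- p (- x)) => _ [r Ar <-]; have [sr rp] := HA r Ar.
  by have := sublinearN x sr; have := rp (- x); lra.
have Sle x r : A r -> inf (S x) <= r x.
  by move=> Ar; apply: ge_inf; [exact: (lbS x).2|exists r].
exists (fun x => inf (S x)); last by move=> r Ar x; exact: Sle.
split=> [x y|t x t0].
  apply/ler_addgt0Pr => e e0.
  have e20 : 0 < e / 2 by rewrite divr_gt0.
  have [_ [r Ar <-] Hr] := inf_adherent e20 (lbS x).
  have [_ [s As <-] Hs] := inf_adherent e20 (lbS y).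
  have [rs|sr] := totA r s Ar As.
    have [[rD _] _] := HA r Ar.
    by have := Sle (x + y) r Ar; have := rD x y; have := rs y; lra.
  have [[sD _] _] := HA s As.
  by have := Sle (x + y) s As; have := sD x y; have := sr x; lra.
rewrite -ler_pdivrMl//; apply: lb_le_inf; first exact: (lbS x).1.
move=> _ [r Ar <-]; rewrite ler_pdivrMl//; have [[_ rZ] _] := HA r Ar.
exact: le_trans (Sle _ _ Ar) (rZ _ _ t0).
Qed.

Lemma sublinear_minimal p : sublinear p ->
  exists2 m, sublinear m /\ (forall x, m x <= p x) &
    forall r, sublinear r -> (forall x, r x <= m x) -> r = m.
Proof.
move=> sp; pose T := {r : V -> R | sublinear r /\ forall x, r x <= p x}.
pose le (r s : T) := `[< forall x, sval s x <= sval r x >].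
pose pT : T := exist _ p (conj sp (fun x => lexx (p x))).
have [||||m mmax] := @Zorn T le.
- by move=> r; apply/asboolP.
- move=> r s t /asboolP rs /asboolP st; apply/asboolP => x.
  exact: le_trans (st x) (rs x).
- move=> [r pr] [s ps] /asboolP/= rs /asboolP/= sr; apply: eq_exist.
  by apply/funext => x; apply/eqP; rewrite eq_le rs sr.
- move=> A totA.
  (* Adding [p] makes the chain nonempty and keeps its infimum below [p]. *)
  pose A' := [set sval r | r in A] `|` [set p].
  have [||||m sm mA] := @sublinear_chain_inf p A' => //.
  + by right.
  + by move=> _ [[r Ar <-]|->]; [exact: (svalP r)|].
  + move=> _ _ [[r Ar <-]|->] [[s As <-]|->].
    * by case: (totA r s Ar As) => /asboolP; [right|left].
    * by left; case: (svalP r).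
    * by right; case: (svalP s).
    * by left.
  have mp x : m x <= p x by apply: mA; right.
  exists (exist _ m (conj sm mp)) => r Ar; apply/asboolP => x /=.
  by apply: mA; left; exists r.
exists (sval m); first exact: (svalP m).
move=> r sr rm.
have rp x : r x <= p x by apply: le_trans (rm x) _; case: (svalP m).
suff <- : exist _ r (conj sr rp) = m by [].
by apply: mmax; apply/asboolP.
Qed.

(** A minimal sublinear functional is odd, since [sublinear_lower] cannot lower it further, and an
    odd one is linear. Lowering [p] at [v] beforehand forces the value at [v]. *)
Lemma hahn_banach p v : sublinear p ->
  exists f : {scalar V}, (forall x, f x <= p x) /\ f v = p v.
Proof.
move=> sp; have [p' [sp' p'p] p'v] := sublinear_lower v sp.
have [m [sm mp'] mmin] := sublinear_minimal sp'.
have mN x : m (- x) = - m x.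
  have [r [sr rm] rx] := sublinear_lower x sm.
  have rE := mmin r sr rm; rewrite rE in rx.
  by apply/eqP; rewrite eq_le rx/=; have := sublinearN x sm; lra.
have mD x y : m (x + y) = m x + m y.
  have [D _] := sm; apply/eqP; rewrite eq_le D/=.
  by have := D (x + y) (- y); rewrite addrK mN; lra.
have mZ t x : m (t *: x) = t * m x.
  have [t0|t0] := leP 0 t; first exact: sublinearZ.
  rewrite -[t]opprK scaleNr mN sublinearZ// ?mulNr//.
  by rewrite oppr_ge0 ltW.
have mlin : scalar m by move=> a x y; rewrite mD mZ.
pose mL := GRing.isLinear.Build R V R _ m mlin.
pose f : {scalar V} := HB.pack m mL.
exists f; split=> [x|]; first exact: le_trans (mp' x) (p'p x).
apply/eqP; rewrite eq_le (le_trans (mp' v) (p'p v))/=.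
by have := mp' (- v); have : m (- v) = - m v by []; rewrite /f/=; lra.
Qed.

Lemma convex_setP (A : set V) : convex_set A <->
  (forall x y t, A x -> A y -> 0 <= t -> t <= 1 -> A (t *: x + (1 - t) *: y)).
Proof.
split=> [cA x y t Ax Ay t0 t1|cA x y l].
  by have := cA x y (Itv01 t0 t1); rewrite !inE; exact.
rewrite !inE => Ax Ay; apply: (cA x y l%:num) => //.
Qed.

(* via the gauge of [O] *)
Lemma hahn_banach_convex (O : set V) v : convex_set O ->
  (forall x, exists2 r, 0 < r & O (r *: x)) -> ~ O v ->
  exists f : {scalar V}, (forall x, O x -> f x <= 1) /\ 1 <= f v.
Proof.
move=> /convex_setP cO absO Ov.
have O0 : O 0 by have [r _] := absO 0; rewrite scaler0.
pose S x := [set t | 0 < t /\ O (t^-1 *: x)].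
have lbS x : has_inf (S x).
  split; last by exists 0 => t [/ltW].
  by have [r r0 Or] := absO x; exists r^-1; split; rewrite ?invr_gt0 ?invrK.
have Sle x t : 0 < t -> O (t^-1 *: x) -> inf (S x) <= t.
  by move=> t0 Ot; apply: ge_inf; [exact: (lbS x).2|split].
have sg : sublinear (fun x => inf (S x)).
  split=> [x y|t x t0].
    apply/ler_addgt0Pr => e e0.
    have e20 : 0 < e / 2 by rewrite divr_gt0.
    have [s [s0 Os] Hs] := inf_adherent e20 (lbS x).
    have [t [t0 Ot] Ht] := inf_adherent e20 (lbS y).
    suff /(Sle _ _ (addr_gt0 s0 t0)) : O ((s + t)^-1 *: (x + y)) by lra.
    have st0 := addr_gt0 s0 t0.
    have := cO _ _ (s / (s + t)) Os Ot; rewrite !scalerA.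
    rewrite (_ : s / (s + t) / s = (s + t)^-1); last by field; rewrite !gt_eqF.
    rewrite (_ : (1 - _) / t = (s + t)^-1); last by field; rewrite !gt_eqF.
    rewrite -scalerDr; apply; first by rewrite divr_ge0// ltW.
    by rewrite ler_pdivrMr// mul1r lerDl ltW.
  rewrite -ler_pdivrMl//; apply: lb_le_inf; first exact: (lbS x).1.
  move=> s [s0 Os]; rewrite ler_pdivrMl//; apply: Sle; first exact: mulr_gt0.
  by rewrite scalerA invfM mulrAC mulVf ?gt_eqF// mul1r.
have [f [fle fv]] := hahn_banach v sg; exists f; split=> [x Ox|].
  by apply: le_trans (fle x) _; apply: Sle; rewrite ?invr1 ?scale1r.
rewrite fv leNgt; apply/negP => lt1.
have [t [t0 Ot] t1] : exists2 t, S v t & t < 1.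
  have e0 : 0 < 1 - inf (S v) by rewrite subr_gt0.
  by have [t St Ht] := inf_adherent e0 (lbS v); exists t => //; lra.
apply: Ov; have := cO _ _ t Ot O0 (ltW t0) (ltW t1).
by rewrite scalerA divff ?gt_eqF// scale1r scaler0 addr0.
Qed.

End HahnBanach.

(** * Bounded limits along ultrafilters, and supporting slopes in the plane *)

Lemma ultra_cvg_bounded (R : realType) T (U : set_system T) (f : T -> R) M :
  UltraFilter U -> (\forall t \near U, `|f t| <= M) -> f @ U --> lim (f @ U).
Proof.
move=> UU fM; apply/cvg_ex.
have FfU : (f @ U) `[- M, M]%classic.
  by apply: filterS fM => t; rewrite ler_norml /= in_itv.
have [l [_ cl]] := @segment_compact R (- M) M (f @ U) _ FfU.
exists l => N Nl; have [//|UN] := in_ultra_setVsetC (f @^-1` N) UU.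
by have [r []] := cl (~` N) N UN Nl.
Qed.

(** A planar Hahn-Banach theorem: the slope is the supremum of [(q - L) / p] over the points with
    [0 < p]. Symmetry and convexity bound these quotients by [(L + q) / p]. *)
Lemma symmetric_convex_slope (R : realType) (S : set (R * R)) L :
  (forall p q, S (p, q) -> S (- p, - q)) ->
  (forall p q p' q' t, S (p, q) -> S (p', q') -> 0 <= t -> t <= 1 ->
    S (t * p + (1 - t) * p', t * q + (1 - t) * q')) ->
  (forall q, S (0, q) -> q <= L) ->
  exists t, forall p q, S (p, q) -> q - t * p <= L.
Proof.
move=> Sn Sc S0.
have [[p0 [q0 [p00 S00]]]|noS] :=
    pselect (exists p q, 0 < p /\ S (p, q)); last first.
  exists 0 => p q Spq; rewrite mul0r subr0.
  have [p0|p0|p0] := ltgtP p 0; last by rewrite p0 in Spq; exact: S0.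
    exfalso; apply: noS; exists (- p), (- q); rewrite oppr_gt0.
    by split=> //; exact: Sn.
  by exfalso; apply: noS; exists p, q.
pose T := [set (u.2 - L) / u.1 | u in [set u | 0 < u.1 /\ S u]].
have Tub p q : 0 < p -> S (p, q) -> ubound T ((L + q) / p).
  move=> p1 Spq _ [[p' q'] /= [p'0 Sp'q'] <-].
  (* This weight makes the first coordinate vanish, so that [S0] applies to the combination. *)
  have := Sc _ _ _ _ (p' / (p + p')) (Sn _ _ Spq) Sp'q'.
  have pp0 : 0 < p + p' by rewrite addr_gt0.
  rewrite (_ : _ * - p + _ = 0); last by field; rewrite gt_eqF.
  rewrite (_ : _ * - q + _ = (p * q' - p' * q) / (p + p')); last first.
    by field; rewrite gt_eqF.
  move=> /(_ (divr_ge0 (ltW p'0) (ltW pp0))).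
  rewrite ler_pdivrMr// mul1r lerDr => /(_ (ltW p1)) /S0.
  rewrite ler_pdivrMr// => H.
  by rewrite ler_pdivrMr// mulrAC ler_pdivlMr//; lra.
have supT : has_sup T.
  split; first by exists ((q0 - L) / p0), (p0, q0).
  by exists ((L + q0) / p0); exact: Tub.
exists (sup T) => p q Spq.
have [p1|p1|p1] := ltgtP p 0.
- have Np : 0 < - p by rewrite oppr_gt0.
  have := ge_sup supT.1 (Tub _ _ Np (Sn _ _ Spq)).
  by rewrite ler_pdivlMr//; lra.
- have : (q - L) / p <= sup T.
    by apply: sup_upper_bound => //; exists (p, q).
  by rewrite ler_pdivrMr//; lra.
- by rewrite p1 mulr0 subr0; apply: S0; rewrite -p1.
Qed.

(** * Polars of neighbourhoods of 0, and strict separation *)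

Section Polar.
Context (R : realType) (X : tvsType R).
Implicit Types (O : set X) (h : X -> R).

Definition absconvex O := [/\ nbhs 0 O, convex_set O & forall x, O x -> O (- x)].

(** Functionals stay unbundled so that combinations and pointwise limits can be written as plain
    functions; [dualfP] returns to [dual]. *)
Definition dualf h := scalar h /\ continuous h.

Definition polar O h := scalar h /\ forall x, O x -> h x <= 1.

Lemma dualfP h : dualf h -> exists f : dual X, h = f.
Proof.
move=> [hl hc]; pose hL := GRing.isLinear.Build R X R _ h hl.
pose f : {scalar X} := HB.pack h hL.
by exists (exist (fun f : {scalar X} => continuous (f : X -> R)) f hc).
Qed.

Lemma scalar_funD h x y : scalar h -> h (x + y) = h x + h y.
Proof. by move=> hl; have := hl 1 x y; rewrite scale1r mul1r. Qed.

Lemma scalar_fun0 h : scalar h -> h 0 = 0.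
Proof. by move=> hl; have := scalar_funD 0 0 hl; rewrite addr0; lra. Qed.

Lemma scalar_funZ h t x : scalar h -> h (t *: x) = t * h x.
Proof. by move=> hl; have := hl t x 0; rewrite !addr0 scalar_fun0// addr0. Qed.

Lemma scalar_funN h x : scalar h -> h (- x) = - h x.
Proof. by move=> hl; rewrite -scaleN1r scalar_funZ// mulN1r. Qed.

Lemma scalar_funB h x y : scalar h -> h (x - y) = h x - h y.
Proof. by move=> hl; rewrite scalar_funD// scalar_funN. Qed.

Lemma absconvexI O W : absconvex O -> absconvex W -> absconvex (O `&` W).
Proof.
move=> [nO /convex_setP cO sO] [nW /convex_setP cW sW]; split.
- exact: filterI.
- by apply/convex_setP => x y t [? ?] [? ?] ? ?; split; [exact: cO|exact: cW].
- by move=> x [? ?]; split; [exact: sO|exact: sW].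
Qed.

Lemma nbhs_absconvex U : nbhs (0 : X) U -> exists2 O, absconvex O & O `<=` U.
Proof.
move=> nU; have [B cB [oB bB]] := @locally_convex R X.
have [V [BV V0] VU] := bB 0 U nU.
have nV : nbhs (0 : X) V by apply: open_nbhs_nbhs; split=> //; exact: oB.
have /convex_setP cV : convex_set V by apply: cB; rewrite inE.
exists (V `&` -%R @` V); last by move=> x [/VU].
split.
- by apply: filterI => //; exact: nbhs0N.
- apply/convex_setP => x y t [Vx [x' Vx' xE]] [Vy [y' Vy' yE]] t0 t1.
  split; first exact: cV.
  exists (t *: x' + (1 - t) *: y'); first exact: cV.
  by rewrite opprD -!scalerN xE yE.
- by move=> x [Vx [y Vy yx]]; split; [rewrite -yx opprK|exists x].
Qed.

Lemma absorbing U x : nbhs (0 : X) U -> exists2 r : R, 0 < r & U (r *: x).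
Proof.
move=> nU.
have : (r *: x) @[r --> (0 : R^o)] --> (0 : X).
  rewrite -(scale0r x).
  apply: (@continuous2_cvg _ _ _ _ _ _ (fun r : R^o => r) (fun=> x)
    (fun (r : R^o) (y : X) => r *: y)).
  - exact: (@scale_continuous R X (0, x)).
  - exact: cvg_id.
  - exact: cvg_cst.
move=> /(_ U nU) [e /= e0 He]; exists (e / 2); first by rewrite divr_gt0.
apply: He; rewrite /= sub0r normrN gtr0_norm ?divr_gt0//.
by rewrite ltr_pdivrMr// ltr_pMr// ltr1n.
Qed.

Lemma polar_norm O h x : absconvex O -> polar O h -> O x -> `|h x| <= 1.
Proof.
move=> [_ _ sO] [hl hO] Ox; rewrite ler_norml hO// andbT.
by have := hO _ (sO _ Ox); rewrite scalar_funN//; lra.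
Qed.

Lemma polar_dualf O h : nbhs 0 O -> polar O h -> dualf h.
Proof.
move=> /nbhs_absconvex[W aW WO] [hl hO]; split=> // x.
have hW : polar W h by split=> // y /WO; exact: hO.
apply/cvgrPdist_le => e e0.
have nW : nbhs (0 : X) W by case: aW.
have := nbhsT x (nbhs0Z (lt0r_neq0 e0) nW).
apply: filterS => _ [_ [y Wy <-] <-].
rewrite scalar_funD// opprD addrA subrr add0r normrN scalar_funZ// normrM gtr0_norm//.
by rewrite ler_piMr ?(ltW e0)//; exact: polar_norm hW Wy.
Qed.

Lemma dualf_polar h e : dualf h -> 0 < e ->
  exists2 O, absconvex O & polar O (fun x => e^-1 * h x).
Proof.
move=> [hl hc] e0.
have /nbhs_absconvex[W aW WU] : nbhs (0 : X) [set x | h x <= e].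
  have := hc 0; rewrite /continuous_at scalar_fun0// => h0.
  by apply: (cvgr_le _ h0).
exists W => //; split=> [a x y|x /WU /=]; last by rewrite ler_pdivrMl// mulr1.
by rewrite hl; ring.
Qed.

Lemma polar_convex O h k t : polar O h -> polar O k -> 0 <= t -> t <= 1 ->
  polar O (fun x => t * h x + (1 - t) * k x).
Proof.
move=> [hl hO] [kl kO] t0 t1; split=> [a x y|x Ox]; first by rewrite hl kl; ring.
have := ler_wpM2l t0 (hO x Ox).
have : 0 <= 1 - t by rewrite subr_ge0.
by move=> t0' ; have := ler_wpM2l t0' (kO x Ox); lra.
Qed.

Lemma polarN O h : absconvex O -> polar O h -> polar O (fun x => - h x).
Proof.
move=> [_ _ sO] [hl hO]; split=> [a x y|x Ox]; first by rewrite hl; ring.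
by rewrite -scalar_funN//; apply/hO/sO.
Qed.

(** With [polar_dualf], this keeps pointwise limits of an equicontinuous family inside the dual. *)
Lemma polar_cvg O T (U : set_system T) (f : T -> X -> R) h : ProperFilter U ->
  (forall t, polar O (f t)) -> (forall x, f t x @[t --> U] --> h x) ->
  polar O h.
Proof.
move=> UU pf cf; split=> [a x y|x Ox]; last first.
  by apply: (cvgr_to_le (cf x)); near=> t; apply: (pf t).2.
apply: (cvg_unique _ (cf (a *: x + y))) => //.
rewrite (_ : (fun t => _) = (fun t => a * f t x + f t y)); last first.
  by apply/funext => t; apply: (pf t).1.
by apply: cvgD; [apply: cvgMr|]; exact: cf.
Unshelve. all: by end_near. Qed.

(** The pointwise form of Alaoglu's theorem: [O] absorbs [x], which bounds the values at [x]
    uniformly over the polar. *)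
Lemma polar_ultra_cvg O T (U : set_system T) (f : T -> X -> R) x :
  nbhs 0 O -> UltraFilter U -> (forall t, polar O (f t)) ->
  f t x @[t --> U] --> lim (f t x @[t --> U]).
Proof.
move=> /nbhs_absconvex[W aW WO] UU pf.
have [nW _ _] := aW; have [r r0 Or] := absorbing x nW.
apply: (@ultra_cvg_bounded _ _ _ _ r^-1); near=> t.
have pt : polar W (f t) by have [fl fO] := pf t; split=> // y /WO; exact: fO.
have := polar_norm aW pt Or; rewrite scalar_funZ; last exact: (pf t).1.
by rewrite normrM gtr0_norm// -ler_pdivlMl// mulr1.
Unshelve. all: by end_near. Qed.

(** Hahn-Banach is applied to [W - C + c0], a convex neighbourhood of 0 that misses [c0 - y] when
    [W] lies in [U]. *)
Lemma separation (C : set X) y U : convex_set C -> C !=set0 -> nbhs 0 U ->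
  (forall u, U u -> ~ C (y + u)) ->
  exists f, dualf f /\ exists2 m, 0 < m & forall c, C c -> f y + m <= f c.
Proof.
move=> /convex_setP cC [c0 Cc0] /nbhs_absconvex[W aW WU] UC.
have [nW /convex_setP cW sW] := aW.
pose V := [set w - c + c0 | w in W & c in C].
have WV : W `<=` V.
  by move=> w Ww; exists w => //; exists c0 => //; rewrite subrK.
have [|||f [fO fv]] := @hahn_banach_convex R X V (c0 - y) _ _ _.
- apply/convex_setP => _ _ t [w Ww [c Cc <-]] [w' Ww' [c' Cc' <-]] t0 t1.
  exists (t *: w + (1 - t) *: w'); first exact: cW.
  exists (t *: c + (1 - t) *: c'); first exact: cC.
  have c0E : c0 = t *: c0 + (1 - t) *: c0.
    by rewrite -scalerDl addrCA subrr addr0 scale1r.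
  rewrite [in LHS]c0E !scalerDr !scalerN opprD.
  by rewrite (addrACA (t *: w)) (addrACA (t *: w - _)).
- by move=> x; have [r r0 /WV ?] := absorbing x nW; exists r.
- move=> [w Ww [c Cc e]]; apply: (UC w); first exact: WU.
  suff -> : y + w = c by [].
  apply/eqP; rewrite -subr_eq0 -addrA; move/eqP: e.
  by rewrite (addrC c0) (inj_eq (addIr c0)) => /eqP ->; rewrite subrr.
exists f; split.
  by apply: (@polar_dualf W) => //; split; [exact: linearP|move=> x /WV/fO].
(* The margin is the factor [r] that shrinks [c0 - y] into [W]. *)
have [r r0 Or] := absorbing (c0 - y) nW.
exists r => // c Cc.
have : f (r *: (c0 - y) - c + c0) <= 1.
  by apply: fO; exists (r *: (c0 - y)) => //; exists c.
rewrite linearD linearB linearZ/=.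
have : r * 1 <= r * f (c0 - y) by rewrite ler_pM2l.
by move: fv; rewrite linearB/=; lra.
Qed.

End Polar.

(** * Evaluation functionals by completeness, and triangular sequences otherwise *)

Section OneSidedJames.
Context (R : realType) (X : tvsType R).
Implicit Types (O : set X) (h : X -> R).

(* Grothendieck's completeness theorem, for a linear form [Z] on the dual. *)
Lemma complete_evaluation (Z : (X -> R) -> R) : tvs_complete X ->
  (forall a h, dualf h -> Z (fun x => a * h x) = a * Z h) ->
  (forall O, absconvex O -> exists x, forall h, polar O h -> Z h - h x <= 4^-1) ->
  exists x, forall h, dualf h -> Z h = h x.
Proof.
move=> complete ZZ Zx; pose S O := [set x | forall h, polar O h -> Z h - h x <= 4^-1].
have SN O h x : absconvex O -> polar O h -> S O x -> `|Z h - h x| <= 4^-1.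
  move=> aO ph Sx; rewrite ler_norml Sx// andbT.
  have := Sx _ (polarN aO ph).
  rewrite (_ : (fun y => - h y) = (fun y => -1 * h y)); last first.
    by apply/funext => y; rewrite mulN1r.
  rewrite ZZ; first by rewrite !mulN1r; lra.
  by have [nO _ _] := aO; exact: polar_dualf ph.
(* [S O] gathers the points whose evaluation is within [4^-1] of [Z] on the polar of [O]. Smaller
   [O] have larger polars, so these sets form a filter base. *)
have FF : ProperFilter (filter_from (@absconvex R X) S).
  apply: filter_from_proper; last by move=> O /Zx.
  apply: filter_from_filter.
    by have [V aV _] := nbhs_absconvex (@filterT _ (nbhs (0 : X)) _); exists V.
  move=> O W aO aW; exists (O `&` W); first exact: absconvexI.
  move=> x Sx; split=> h [hl hO]; apply: Sx; split=> // y [Oy Wy]; exact: hO.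
have [|x Fx] := complete _ FF.
  move=> U /nbhs_absconvex[V aV VU].
  exists (S V, S V); first by split; exists V.
  (* If [x - y] were outside [V], some [f] in the polar of [V] would have [f (x - y) >= 1], whereas
     both values are within [4^-1] of [Z f]. *)
  move=> [x y] /= [Sx Sy]; apply: VU; apply: contrapT => nVxy.
  have [nV cV _] := aV.
  have [|f [fO fv]] := hahn_banach_convex cV _ nVxy.
    by move=> z; have [r] := absorbing z nV; exists r.
  have pf : polar V f by split=> //; exact: linearP.
  have := SN V f x aV pf Sx; have := SN V f y aV pf Sy.
  by move: fv; rewrite linearB/= !ler_norml => ? /andP[? ?] /andP[? ?]; lra.
exists x => h dh; apply/eqP; rewrite -subr_eq0 -normr_le0.
apply/ler_addgt0Pr => e e0; rewrite add0r.
have e20 : 0 < e / 2 by rewrite divr_gt0.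
have [V aV ph] := dualf_polar dh e20.
have [y [Sy hy]] : exists y, S V y /\ `|h x - h y| <= e / 2.
  have : \forall y \near nbhs x, `|h x - h y| <= e / 2.
    by have := dh.2 x => /cvgrPdist_le; apply.
  move=> /Fx nx; have : filter_from (@absconvex R X) S (S V) by exists V.
  by move=> /(filterI nx) /filter_ex[y [? ?]]; exists y.
have := SN V _ y aV ph Sy; rewrite ZZ// -mulrBr normrM gtr0_norm ?invr_gt0//.
rewrite ler_pdivrMl// => Hy.
have -> : Z h - h x = (Z h - h y) - (h x - h y) by ring.
by apply: le_trans (ler_normB _ _) _; lra.
Qed.

(** If no such [h] vanished at [y], the slope lemma for the pairs [(h y, Z h - h x)] would give [t]
    with [Z h - h (x + t *: y) <= L] on all of [C], against the hypothesis at [x + t *: y]. *)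
Lemma annihilating_step (C : set (X -> R)) (Z : (X -> R) -> R) L y :
  (forall h, C h -> scalar h) -> (forall h, C h -> C (fun x => - h x)) ->
  (forall h k t, C h -> C k -> 0 <= t -> t <= 1 ->
    C (fun x => t * h x + (1 - t) * k x)) ->
  (forall h k a b, C h -> C k ->
    Z (fun x => a * h x + b * k x) = a * Z h + b * Z k) ->
  (forall x, exists2 h, C h & L < Z h - h x) ->
  forall x, exists2 h, C h /\ h y = 0 & L < Z h - h x.
Proof.
move=> Cl CN CC ZC Hx x; apply: contrapT => noh.
pose S := [set u : R * R | exists2 h, C h & u = (h y, Z h - h x)].
have ZN h : C h -> Z (fun x => - h x) = - Z h.
  move=> Ch; rewrite (_ : (fun x => - h x) = (fun x => -1 * h x + 0 * h x)).
    by rewrite ZC// mul0r addr0 mulN1r.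
  by apply/funext => z; rewrite mul0r addr0 mulN1r.
have [|||t Ht] := @symmetric_convex_slope R S L.
- move=> _ _ [h Ch [-> ->]]; exists (fun x => - h x); first exact: CN.
  by rewrite ZN//; congr pair; ring.
- move=> _ _ _ _ t [h Ch [-> ->]] [k Ck [-> ->]] t0 t1.
  exists (fun x => t * h x + (1 - t) * k x); first exact: CC.
  by rewrite ZC//; congr pair; ring.
- move=> q [h Ch [hy ->]]; rewrite leNgt; apply/negP => ltL.
  by apply: noh; exists h.
have [h Ch] := Hx (x + t *: y).
have hl := Cl h Ch; rewrite (scalar_funD _ _ hl) (scalar_funZ _ _ hl).
by have := Ht (h y) (Z h - h x); rewrite leNgt => /(_ (ex_intro2 _ _ _ Ch erefl)) /negP; lra.
Qed.

(** Functionals and points are chosen alternately: a functional vanishing at the earlier points with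
    [Z h > L], then a point [phi t] of [K] where all functionals so far exceed [L]. *)
Lemma triangular_sequences O (Z : (X -> R) -> R) L T (U : set_system T)
    (phi : T -> X) (K : set X) : absconvex O -> ProperFilter U ->
  (forall h, dualf h -> h (phi t) @[t --> U] --> Z h) ->
  (\forall t \near U, K (phi t)) ->
  (forall x, exists2 h, polar O h & L < Z h - h x) ->
  exists (f : nat -> X -> R) (x : nat -> X), [/\ forall n, polar O (f n),
    forall n, K (x n), forall j n, (j < n)%N -> f n (x j) = 0 &
    forall n j, (n <= j)%N -> L < f n (x j)].
Proof.
move=> aO UU cZ KU Hx.
have [nO _ _] := aO.
have pd h : polar O h -> dualf h by exact: polar_dualf.
have ZC h k a b : dualf h -> dualf k ->
    Z (fun x => a * h x + b * k x) = a * Z h + b * Z k.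
  move=> dh dk.
  have dhk : dualf (fun x => a * h x + b * k x).
    split=> [c x y|x]; first by rewrite (dh.1 c) (dk.1 c); ring.
    by apply: cvgD; apply: cvgMr; [exact: dh.2|exact: dk.2].
  apply: (cvg_unique _ (cZ _ dhk)) => //.
  by apply: cvgD; apply: cvgMr; exact: cZ.
pose C (Y : set X) := [set h | polar O h /\ forall y, Y y -> h y = 0].
pose inv (s : set (X -> R) * set X) :=
  (forall x, exists2 h, C s.2 h & L < Z h - h x) /\
  \forall t \near U, forall h, s.1 h -> L < h (phi t).
(* The value [(cst 0, 0)] only makes the choice total; it never occurs along [st], where [inv]
   holds. *)
have next s : {a : (X -> R) * X | inv s ->
    [/\ C s.2 a.1, K a.2, forall h, (a.1 |` s.1) h -> L < h a.2 &
        inv (a.1 |` s.1, a.2 |` s.2)]}.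
  apply: cid; have [[Cs Us]|?] := pselect (inv s); last by exists (cst 0, 0).
  have [h Ch] := Cs 0; have [[hl _] _] := Ch; rewrite scalar_fun0// subr0 => Lh.
  have Uh : \forall t \near U, forall k, (h |` s.1) k -> L < k (phi t).
    have Lht : \forall t \near U, L < h (phi t).
      by apply: (cvgr_gt _ (cZ h (pd _ Ch.1))).
    by apply: filterS (filterI Us Lht) => t [Ht Lt] k [->|/Ht].
  have [t [Kt Ht]] := filter_ex (filterI KU Uh).
  exists (h, phi t) => _; split=> //; split=> //= x.
  have [|||||k [[pk kY] kt] Lk] := @annihilating_step (C s.2) Z L (phi t) _ _ _ _ _ x.
  - by move=> k [[]].
  - by move=> k [pk kY]; split; [exact: polarN|move=> y /kY ->; rewrite oppr0].
  - move=> k k' c [pk kY] [pk' kY'] c0 c1; split; first exact: polar_convex.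
    by move=> y Yy; rewrite kY// kY'// !mulr0 addr0.
  - by move=> k k' a b [pk _] [pk' _]; apply: ZC; exact: pd.
  - exact: Cs.
  - by exists k => //; split=> // y [->|/kY].
pose st := fix st n := if n is m.+1 then
  let a := sval (next (st m)) in (a.1 |` (st m).1, a.2 |` (st m).2)
  else (set0, set0) : set (X -> R) * set X.
have inv_st n : inv (st n).
  elim: n => [|n IH] /=; last by have [] := svalP (next (st n)) IH.
  split=> [x|]; last by apply: nearW.
  by have [h ph Lh] := Hx x; exists h.
pose f n := (sval (next (st n))).1; pose x n := (sval (next (st n))).2.
have nextP n := svalP (next (st n)) (inv_st n).
have st_x j n : (j < n)%N -> (st n).2 (x j).
  elim: n => [//|n IH]; rewrite ltnS leq_eqVlt => /predU1P[->|/IH]; first by left.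
  by right.
have st_f j n : (j < n)%N -> (st n).1 (f j).
  elim: n => [//|n IH]; rewrite ltnS leq_eqVlt => /predU1P[->|/IH]; first by left.
  by right.
exists f, x; split=> [n|n|j n jn|n j nj].
- by have [[]] := nextP n.
- by have [_ ?] := nextP n.
- by have [[_ +] _ _ _] := nextP n; apply; exact: st_x.
- have [_ _ + _] := nextP j; apply.
  by move: nj; rewrite leq_eqVlt => /predU1P[->|/st_f]; [left|right].
Qed.

End OneSidedJames.

(** * Convex blocks as binary trees of indices, which form a countable type *)

Inductive mixtree := MLeaf of nat | MNode of mixtree & mixtree.

Fixpoint mixtree_encode t : GenTree.tree nat :=
  match t with
  | MLeaf n => GenTree.Leaf n
  | MNode t u => GenTree.Node 0 [:: mixtree_encode t; mixtree_encode u]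
  end.

Fixpoint mixtree_decode (t : GenTree.tree nat) : option mixtree :=
  match t with
  | GenTree.Leaf n => Some (MLeaf n)
  | GenTree.Node _ [:: t; u] =>
    if (mixtree_decode t, mixtree_decode u) is (Some t', Some u')
    then Some (MNode t' u') else None
  | _ => None
  end.

Lemma mixtree_encodeK : pcancel mixtree_encode mixtree_decode.
Proof. by elim=> [n|t IHt u IHu] //=; rewrite IHt IHu. Qed.

HB.instance Definition _ := Countable.copy mixtree (pcan_type mixtree_encodeK).

Fixpoint leaves_ge n t :=
  match t with
  | MLeaf k => (n <= k)%N
  | MNode t u => leaves_ge n t && leaves_ge n u
  end.

Fixpoint max_leaf t :=
  match t with
  | MLeaf k => k
  | MNode t u => maxn (max_leaf t) (max_leaf u)
  end.

Fixpoint mixval (R : realType) (X : Type) (q : R) (f : nat -> X -> R) t x :=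
  match t with
  | MLeaf k => f k x
  | MNode t u => (1 - q) * mixval q f t x + q * mixval q f u x
  end.

(** * Attained minima exclude triangular sequences *)

Section NoTriangularSequences.
Context (R : realType) (X : tvsType R).
Implicit Types (O : set X) (h : X -> R) (q : R).

Lemma mixval_polar O q (f : nat -> X -> R) t : 0 < q -> q < 1 ->
  (forall n, polar O (f n)) -> polar O (mixval q f t).
Proof.
move=> q0 q1 pf; elim: t => [n|t IHt u IHu]; first exact: pf.
have := @polar_convex _ _ _ _ _ (1 - q) IHt IHu; rewrite subKr; apply.
  by rewrite subr_ge0 ltW.
by rewrite gerBl ltW.
Qed.

Lemma geometric_sum_polar O q (f : nat -> X -> R) n : 0 < q -> q < 1 ->
  (forall n, polar O (f n)) ->
  polar O (fun x => \sum_(k < n) (1 - q) * q ^+ k * f k x).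
Proof.
move=> q0 q1 pf; split=> [a x y|x Ox].
  rewrite mulr_sumr -big_split/=; apply: eq_bigr => k _.
  by rewrite (pf k).1; ring.
suff : \sum_(k < n) (1 - q) * q ^+ k * f k x <= 1 - q ^+ n.
  by move=> /le_trans; apply; rewrite gerBl exprn_ge0// ltW.
elim: n => [|n IH]; first by rewrite big_ord0 expr0 subrr.
rewrite big_ord_recr/= exprS.
have : (1 - q) * q ^+ n * f n x <= (1 - q) * q ^+ n * 1.
  apply: ler_wpM2l; last exact: ((pf n).2 _ Ox).
  by apply: mulr_ge0; [rewrite subr_ge0 ltW|rewrite exprn_ge0// ltW].
by move: IH; lra.
Qed.

Lemma mixval_gt q (f : nat -> X -> R) t x L : 0 < q -> q < 1 ->
  (forall n, (n <= max_leaf t)%N -> L < f n x) -> L < mixval q f t x.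
Proof.
move=> q0 q1; elim: t => [n|t IHt u IHu] /= Hf; first exact: Hf.
have Ht : L < mixval q f t x by apply: IHt => n nt; apply: Hf; rewrite leq_max nt.
have Hu : L < mixval q f u x.
  by apply: IHu => n nu; apply: Hf; rewrite leq_max nu orbT.
have q1' : 0 < 1 - q by rewrite subr_gt0.
by move: Ht Hu; rewrite -(ltr_pM2l q1') -(ltr_pM2l q0 L); lra.
Qed.

Lemma mixval_eq0 q (f : nat -> X -> R) t x N :
  (forall n, (N <= n)%N -> f n x = 0) -> leaves_ge N t -> mixval q f t x = 0.
Proof.
move=> f0; elim: t => [n|t IHt u IHu] /=; first exact: f0.
by move=> /andP[/IHt -> /IHu ->]; rewrite !mulr0 addr0.
Qed.

(** The infimum [c] is given by its characteristic properties, so that no default value of [inf]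
    interferes. *)
Definition attains_positive_minimum (K : set X) h := forall c, 0 < c ->
  (forall x, K x -> c <= h x) ->
  (forall e, 0 < e -> exists2 x, K x & h x < c + e) ->
  exists2 x, K x & h x = c.

(** [not_attained] is used on [K] with [F = 1 / p], [b = m^-1] and the blocks multiplied by [c / p];
    attainment for a linear functional then contradicts it. *)
Lemma no_triangular_sequences (K : set X) p m M1 M L O (f : nat -> X -> R)
    (xs : nat -> X) : absconvex O ->
  (forall h x, polar O h -> K x -> `|h x| <= M) ->
  dualf p -> 0 < m -> (forall x, K x -> m <= p x <= M1) -> 0 < L ->
  (forall h, dualf h -> attains_positive_minimum K h) ->
  (forall n, polar O (f n)) -> (forall n, K (xs n)) ->
  (forall j n, (j < n)%N -> f n (xs j) = 0) ->
  (forall n j, (n <= j)%N -> L < f n (xs j)) -> False.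
Proof.
move=> aO KM dp m0 pK L0 att pf Kxs fxs0 fxsL.
have [nO _ _] := aO.
have p_gt0 x : K x -> 0 < p x by move=> /pK/andP[mp _]; exact: lt_le_trans mp.
have M1_gt0 : 0 < M1.
  by have /andP[_] := pK _ (Kxs 0%N); apply: lt_le_trans; exact: p_gt0.
have M_ge0 : 0 <= M.
  by apply: le_trans (KM _ _ (pf 0%N) (Kxs 0%N)); rewrite normr_ge0.
(* Since [p <= M1] on [K], a block value above [L] becomes at least [2 * m^-1 + 1] after
   multiplication by [c / p], as [farC] demands. *)
pose c := (2 * m^-1 + 1) * M1 / L.
have c_gt0 : 0 < c.
  by rewrite divr_gt0// mulr_gt0// addr_gt0// mulr_gt0// invr_gt0.
have cL : c * L = (2 * m^-1 + 1) * M1 by rewrite /c divfK ?gt_eqF.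
clearbody c; pose Mev := c * M / m.
have Mev_ge0 : 0 <= Mev by apply: divr_ge0; [apply: mulr_ge0 => //|]; exact: ltW.
(* The summand 2 keeps [q < 1] even when [Mev] is 0. *)
pose q := (8 * Mev + 2)^-1.
have d_gt0 : 0 < 8 * Mev + 2 by lra.
have q_gt0 : 0 < q by rewrite invr_gt0.
have q_lt1 : q < 1 by rewrite invf_lt1//; lra.
have qM : 8 * (q * Mev) <= 1 by rewrite mulrCA mulrC ler_pdivrMr//; lra.
pose E := {x | K x}; pose v := mixval q f.
have pv t : polar O (v t) by exact: mixval_polar.
pose ev t (x : E) := c * v t (sval x) / p (sval x).
have ev_mix i j x : ev (MNode i j) x = (1 - q) * ev i x + q * ev j x.
  by rewrite /ev /v/=; ring.
have ev_le t x : `|ev t x| <= Mev.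
  have /andP[mp _] := pK _ (svalP x).
  rewrite /ev /Mev !normrM normfV (gtr0_norm c_gt0) (gtr0_norm (p_gt0 _ (svalP x))).
  have px := p_gt0 _ (svalP x); apply: ler_pM.
  - by apply: mulr_ge0 => //; exact: ltW.
  - by rewrite invr_ge0 ltW.
  - by rewrite ler_pM2l//; apply: KM => //; exact: (svalP x).
  - by rewrite lef_pV2// posrE.
have F_le (x : E) : `|(p (sval x))^-1| <= m^-1.
  have /andP[mp _] := pK _ (svalP x); have p0 := p_gt0 _ (svalP x).
  by rewrite normfV gtr0_norm// lef_pV2// posrE.
pose x0 : E := exist _ (xs 0%N) (Kxs 0%N).
pose C n := [set t | leaves_ge n t].
have tC : tails MNode C.
  split=> [n|n t|n i j Ci Cj]; first by exists (MLeaf n); exact: leqnn.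
    rewrite /C/=; elim: t => [k|t IHt u IHu] /=; first exact: ltnW.
    by move=> /andP[/IHt -> /IHu ->].
  by rewrite /C/= Ci Cj.
(* At the point indexed by the largest leaf of [t], all leaves of [t] exceed [L], while blocks
   starting one index later vanish. *)
have farC t : exists x n, forall j, C n j -> 2 * m^-1 + 1 + ev j x <= ev t x.
  set N := max_leaf t; exists (exist _ (xs N) (Kxs N)), N.+1 => j Cj.
  have p0 := p_gt0 _ (Kxs N).
  rewrite /ev/= (_ : v j (xs N) = 0); last first.
    by apply: mixval_eq0 Cj => n; exact: fxs0.
  rewrite mulr0 mul0r addr0 ler_pdivlMr//.
  have /andP[_ pM1] := pK _ (Kxs N).
  apply: (@le_trans _ _ ((2 * m^-1 + 1) * M1)).
    by rewrite ler_wpM2l// addr_ge0// mulr_ge0// invr_ge0 ltW.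
  rewrite -cL ler_wpM2l ?(ltW c_gt0)// ltW//; apply: mixval_gt => // n.
  exact: fxsL.
have [g _ Hg] := not_attained x0 q_gt0 q_lt1 ev_mix ev_le F_le tC qM farC.
have [U [UU ooU]] := @ultraFilterLemma nat \oo _.
pose W x := lim (v (g n) x @[n --> U]).
have cW x : v (g n) x @[n --> U] --> W x 
  by exact: (polar_ultra_cvg nO UU (fun n => pv (g n))).
pose S x := lim ((\sum_(k < n) (1 - q) * q ^+ k * v (g k) x) @[n --> U]).
have pS n : polar O (fun x => \sum_(k < n) (1 - q) * q ^+ k * v (g k) x).
  exact: (geometric_sum_polar n q_gt0 q_lt1 (fun k => pv (g k))).
have cS x : (\sum_(k < n) (1 - q) * q ^+ k * v (g k) x) @[n --> U] --> S x.
  exact: (polar_ultra_cvg nO UU pS).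
have pW : polar O W by apply: polar_cvg cW => n; exact: pv.
have pS' : polar O S by exact: polar_cvg pS cS.
pose H x := c * (S x - W x).
pose Q x := (1 + H x) / p x.
have [x maxQ] : exists x : E, forall y : E, Q (sval y) <= Q (sval x).
  pose T := [set Q y | y in K].
  have supT : has_sup T.
    split; first by exists (Q (xs 0%N)), (xs 0%N).
    exists ((1 + c * (2 * M)) / m) => _ [y Ky <-].
    have /andP[mp _] := pK _ Ky; have py := p_gt0 _ Ky.
    have Hy : 1 + H y <= 1 + c * (2 * M).
      rewrite lerD2l ler_pM2l//.
      by have := KM _ _ pW Ky; have := KM _ _ pS' Ky; rewrite !ler_norml; lra.
    rewrite /Q ler_pdivrMr// (le_trans Hy)// mulrAC ler_pdivlMr// ler_wpM2l//.
    by have := mulr_ge0 (ltW c_gt0) M_ge0; lra.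
  (* On [K], [Q y <= sup T] amounts to [1 <= h y], with equality at the same points; approximating
     [sup T] within [e / M1] gives [h y < 1 + e]. So [h] has infimum 1. *)
  pose h y := sup T * p y - H y.
  have dh : dualf h.
    have [_ cS'] := polar_dualf nO pS'; have [_ cW'] := polar_dualf nO pW.
    split=> [a y z|y]; first by rewrite /h /H dp.1 pS'.1 pW.1; ring.
    apply: cvgB; apply: cvgMr; first exact: dp.2.
    by apply: cvgB; [exact: cS'|exact: cW'].
  have [||x Kx hx] := att h dh 1 ltr01.
  - move=> y Ky; have : Q y <= sup T by apply: sup_upper_bound => //; exists y.
    by rewrite ler_pdivrMr ?p_gt0// /h; lra.
  - move=> e e0; have eM : 0 < e / M1 by rewrite divr_gt0.
    have [_ [y Ky <-] Qy] := sup_adherent eM supT; exists y => //.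
    have py := p_gt0 _ Ky; have /andP[_ pM] := pK _ Ky.
    move: Qy; rewrite ltr_pdivlMr// mulrBl.
    have : e / M1 * p y <= e.
      by rewrite mulrAC ler_pdivrMr// ler_wpM2l// ltW.
    by rewrite /h; lra.
  exists (exist _ x Kx) => y /=.
  have -> : Q x = sup T.
    apply/eqP; rewrite eq_sym -subr_eq0 /Q; apply/eqP.
    have px := p_gt0 _ Kx; apply: (mulIf (lt0r_neq0 px)).
    by rewrite mul0r mulrBl divfK ?gt_eqF//; move: hx; rewrite /h; lra.
  by apply: sup_upper_bound => //; exists (sval y) => //; exact: (svalP y).
have QE (y : E) : (p (sval y))^-1 + c * S (sval y) / p (sval y) -
    c * W (sval y) / p (sval y) = Q (sval y).
  by rewrite /Q /H; ring.
have [y|y|y] := Hg U (fun x => c * W (sval x) / p (sval x))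
  (fun x => c * S (sval x) / p (sval x)) _ ooU _ _ x.
- by apply: cvgMl; apply: cvgMr; exact: cW.
- have -> : (fun n => \sum_(k < n) (1 - q) * q ^+ k * ev (g k) y) =
    (fun n => c * (\sum_(k < n) (1 - q) * q ^+ k * v (g k) (sval y)) / p (sval y)).
    apply/funext => n; rewrite mulr_sumr mulr_suml; apply: eq_bigr => k _.
    by rewrite /ev; ring.
  by apply: cvgMl; apply: cvgMr; exact: cS.
- by rewrite !QE ltNge maxQ.
Qed.

End NoTriangularSequences.

(** * From attained minima to weak limits of ultrafilters and weak compactness *)

Section WeakCompactness.
Context (R : realType) (X : tvsType R).
Implicit Types (A B K O : set X) (h : X -> R).

(** If the limit [Z] is no evaluation, completeness provides one polar on which every evaluation
    misses [Z] by more than [4^-1], which starts the triangular sequences. *)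
Lemma one_sided_james T (U : set_system T) (phi : T -> X) K p m :
  tvs_complete X -> UltraFilter U -> (\forall t \near U, K (phi t)) ->
  (forall O, absconvex O ->
    exists M, forall h x, polar O h -> K x -> `|h x| <= M) ->
  dualf p -> 0 < m -> (forall x, K x -> m <= p x) ->
  (forall h, dualf h -> attains_positive_minimum K h) ->
  exists x, forall h, dualf h -> h (phi t) @[t --> U] --> h x.
Proof.
move=> complete UU KU KM dp m0 pm att.
pose Z h : R := lim (h (phi t) @[t --> U]).
have bounded h : dualf h -> exists M, forall x, K x -> `|h x| <= M.
  move=> dh; have [V aV] := dualf_polar dh ltr01.
  have [M HM] := KM V aV => ph; exists M => x /(HM _ _ ph).
  by rewrite invr1 mul1r.
have cZ h : dualf h -> h (phi t) @[t --> U] --> Z h.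
  move=> /bounded[M HM]; apply: (@ultra_cvg_bounded _ _ _ _ M).
  by apply: filterS KU => t /HM.
suff [x Zx] : exists x, forall h, dualf h -> Z h = h x.
  by exists x => h dh; rewrite -Zx//; exact: cZ.
apply: complete_evaluation => // [a h dh|O aO].
  apply: (cvg_unique _ (cZ _ _)) => //; last by apply: cvgMr; exact: cZ.
  split=> [b x y|x]; first by rewrite dh.1; ring.
  by apply: cvgMr; exact: dh.2.
apply: contrapT => noO.
have Hx x : exists2 h, polar O h & 4^-1 < Z h - h x.
  apply: contrapT => no; apply: noO; exists x => h ph.
  by rewrite leNgt; apply/negP => lt; apply: no; exists h.
have [f [xs [pf Kxs fxs0 fxsL]]] := triangular_sequences aO _ cZ KU Hx.
have [M HM] := KM O aO; have [M1 HM1] := bounded p dp.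
apply: (@no_triangular_sequences R X K p m M1 M 4^-1 O f xs) => // x Kx.
by rewrite pm//= (le_trans (ler_norm _)) ?HM1.
Qed.

Lemma bounded_polar A O : tvs_bounded A -> absconvex O ->
  exists M, forall h x, polar O h -> A x -> `|h x| <= M.
Proof.
move=> bA aO; have [nO _ _] := aO; have [r r0 Hr] := bA O nO.
exists (r + 1) => h x ph /(Hr (r + 1) _)[|u Ou <-]; first by rewrite ltrDl.
have r1 : 0 < r + 1 by rewrite addr_gt0.
rewrite (scalar_funZ _ _ ph.1) normrM gtr0_norm// ler_piMr ?(ltW r1)//.
exact: (polar_norm aO ph Ou).
Qed.

Lemma weak_cvg (F : set_system X) (x : X) : Filter F ->
  (forall h, dualf h -> h @ F --> h x) -> (F : set_system (weak X)) --> (x : weak X).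
Proof.
move=> FF Fx; apply/cvg_sup => f V /= [_ [[N oN <-] Nx] NV].
have df : dualf f by split; [exact: linearP|exact: (svalP f)].
have /= : (f @ F) N by apply: (Fx f df); exact: open_nbhs_nbhs.
by apply: filterS => y /NV.
Qed.

(** Only membership of the limit in [A] has to be shown: a limit outside would be strictly separated
    from [A], and the strict gap survives along the ultrafilter. *)
Lemma weakly_compact_ultra A : closed A -> convex_set A -> A !=set0 ->
  (forall F : set_system X, UltraFilter F -> F A ->
    exists x, forall h, dualf h -> h @ F --> h x) -> weakly_compact A.
Proof.
move=> clA cA A0 HA; rewrite /weakly_compact compact_ultra => F FU FA.
have [x Fx] := HA F FU FA; exists x; split; last exact: weak_cvg.
apply: contrapT => nAx.
have [||f [df [m m0 fm]]] := @separation R X A x [set u | ~ A (x + u)] cA A0 => //.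
  have : nbhs x (~` A) by apply: open_nbhs_nbhs; split=> //; exact: closed_openC.
  move=> /(nbhsB (- x)); rewrite addNr; apply: filterS => _ [y Ay <-].
  by rewrite /= addNKr.
have : f x + m <= f x.
  by apply: (cvgr_to_ge (Fx f df)); rewrite near_simpl; apply: (@filterS _ F _ A) => // a; exact: fm.
by rewrite gerDl leNgt m0.
Qed.

End WeakCompactness.

Theorem corollary3p8 (R : realType) (X : tvsType R)
  (X_hausdorff : hausdorff_space X) (X_complete : tvs_complete X)
  (A B : set X)
  (A_nonempty : A !=set0) (B_nonempty : B !=set0)
  (A_bounded : tvs_bounded A) (B_bounded : tvs_bounded B)
  (A_closed : closed A) (B_closed : closed B)
  (A_convex : convex_set A) (B_convex : convex_set B)
  (AB_separated : ~ closure [set a - b | a in A & b in B] 0)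
  (AB_attained : forall f : dual X,
     sup (f @` B) < inf (f @` A) -> attains_inf f A /\ attains_sup f B) :
  weakly_compact A /\ weakly_compact B.
Proof.
pose K := [set a - b | a in A & b in B].
have [a0 Aa0] := A_nonempty; have [b0 Bb0] := B_nonempty.
have K0 : K !=set0 by exists (a0 - b0); exists a0 => //; exists b0.
have cK : convex_set K.
  have /convex_setP cA := A_convex; have /convex_setP cB := B_convex.
  apply/convex_setP => _ _ t [a Aa [b Bb <-]] [a' Aa' [b' Bb' <-]] t0 t1.
  exists (t *: a + (1 - t) *: a'); first exact: cA.
  exists (t *: b + (1 - t) *: b'); first exact: cB.
  by rewrite !scalerBr opprD addrACA.
have bK O : absconvex O ->
    exists M, forall h x, polar O h -> K x -> `|h x| <= M.
  move=> aO; have [M HM] := bounded_polar A_bounded aO.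
  have [N HN] := bounded_polar B_bounded aO.
  exists (M + N) => h _ ph [a Aa [b Bb <-]]; rewrite (scalar_funB _ _ ph.1).
  by rewrite (le_trans (ler_normB _ _))// lerD// ?HM ?HN.
have [p [dp [m m0 pm]]] : exists p, dualf p /\ exists2 m, 0 < m &
    forall x, K x -> m <= p x.
  have [U nU UK] : exists2 U, nbhs (0 : X) U & forall x, U x -> ~ K x.
    apply: contrapT => noU; apply: AB_separated => U nU.
    apply: contrapT => UK0; apply: noU; exists U => // x Ux Kx.
    by apply: UK0; exists x.
  have [|p [dp [m m0 pm]]] := separation (y := 0) cK K0 nU.
    by move=> u Uu; rewrite add0r; exact: UK.
  exists p; split=> //; exists m => // x /pm.
  by rewrite (scalar_fun0 dp.1) add0r.
(* On [A - B] the infimum of [h] is its infimum on [A] minus its supremum on [B]. If it is positive,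
   the hypothesis applies, and the difference of the two extremal points attains it. *)
have att h : dualf h -> attains_positive_minimum K h.
  move=> dh c c0 ch hc; have hB := scalar_funB _ _ dh.1.
  have hK a b : A a -> B b -> c <= h a - h b.
    by move=> Aa Bb; rewrite -hB; apply: ch; exists a => //; exists b.
  have supB : has_sup (h @` B).
    split; first by exists (h b0), b0.
    by exists (h a0) => _ [b Bb <-]; have := hK _ _ Aa0 Bb; lra.
  have infA : has_inf (h @` A).
    split; first by exists (h a0), a0.
    by exists (h b0) => _ [a Aa <-]; have := hK _ _ Aa Bb0; lra.
  have supB_lt : sup (h @` B) < inf (h @` A).
    apply: (@lt_le_trans _ _ (sup (h @` B) + c)); first by rewrite ltrDl.
    apply: lb_le_inf; first exact: infA.1.
    move=> _ [a Aa <-]; rewrite -lerBrDr; apply: ge_sup; first exact: supB.1.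
    by move=> _ [b Bb <-]; have := hK _ _ Aa Bb; lra.
  have [f fE] := dualfP dh.
  have := AB_attained f; rewrite -fE => /(_ supB_lt)[[a Aa ha] [b Bb hb]].
  exists (a - b); first by exists a => //; exists b.
  apply/eqP; rewrite eq_le; apply/andP; split; last first.
    by rewrite hB; exact: hK.
  apply/ler_addgt0Pr => e /hc[_ [a' Aa' [b' Bb' <-]]].
  rewrite !hB ha hb => lt_c; apply: le_trans (ltW lt_c).
  apply: lerB; first by apply: ge_inf; [exact: infA.2|exists a'].
  by apply: sup_upper_bound => //; exists b'.
have limK T (U : set_system T) (phi : T -> X) : UltraFilter U ->
    (\forall t \near U, K (phi t)) ->
    exists x, forall h, dualf h -> h (phi t) @[t --> U] --> h x.
  by move=> UU KU; exact: (one_sided_james X_complete UU KU bK dp m0 pm att).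
(* Ultrafilters on [A] and [B] are carried into [K] by [a - b0] and [a0 - b], and the weak limit is
   carried back. *)
split; apply: weakly_compact_ultra => // F FU FA.
  have [|x Hx] := limK X F (fun a => a - b0) FU.
    by apply: (@filterS _ F _ A) => // a Aa; exists a => //; exists b0.
  exists (x + b0) => h dh; rewrite (scalar_funD _ _ dh.1).
  have {1}-> : h = (fun a => h (a - b0) + h b0).
    by apply/funext => a; rewrite (scalar_funB _ _ dh.1) subrK.
  by apply: cvgD; [exact: Hx|exact: cvg_cst].
have [|x Hx] := limK X F (fun b => a0 - b) FU.
  by apply: (@filterS _ F _ B) => // b Bb; exists a0 => //; exists b.
exists (a0 - x) => h dh; rewrite (scalar_funB _ _ dh.1).
have {1}-> : h = (fun b => h a0 - h (a0 - b)).
  by apply/funext => b; rewrite (scalar_funB _ _ dh.1) opprB addrC subrK.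
by apply: cvgB; [exact: cvg_cst|exact: Hx].
Qed.
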